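(* Let $F$ and $G$ be two fixed distribution functions. For any $z\in(-\infty,\infty)$, let $s=\tau_W(F,G)(z)$. For any $\epsilon>0$ there exists a copula $C_{s,\epsilon}$ such that $$\sigma_{C_{s,\epsilon}}(F,G)(z)<s+\epsilon.$$ In other words, the lower bound $\tau_W(F,G)(z)$ on $J(z)=P(X+Y\le z)$ cannot be improved for any $F,G$, and is thus pointwise best possible in terms of $z$.
   Context: Distribution functions are right-continuous: the distribution function of a real random variable $X$ is $F(x)=P(X\le x)$. $X,Y$ denote real random variables with marginal distribution functions $F,G$ respectively and unspecified joint distribution; $J(z)=P(X+Y\le z)$. A (two-dimensional) copula is a function $C:[0,1]^2\to[0,1]$ with $C(a,0)=C(0,a)=0$, $C(a,1)=C(1,a)=a$ for all $a\in[0,1]$, and $C(a_2,b_2)-C(a_1,b_2)-C(a_2,b_1)+C(a_1,b_1)\ge 0$ whenever $a_1\le a_2$, $b_1\le b_2$ in $[0,1]$. For a copula $C$ and real $z$, $\sigma_C(F,G)(z)=\iint_{x+y\le z}dC(F(x),G(y))$, i.e. $\sigma_C(F,G)(z)=P(X+Y\le z)$ when $(X,Y)$ has joint distribution function $H(x,y)=C(F(x),G(y))$. The Makarov lower bound is $\tau_W(F,G)(z)=\sup_{x+y=z}\max(F(x)+G(y)-1,0)$, the supremum being over real $x,y$; it is a valid lower bound on $P(X+Y\le z)$ for every joint distribution with margins $F,G$. A lower bound $J_\ell(\cdot)$ on $J(\cdot)$ is pointwise best-possible if for all $z_0\in\mathbb{R}$ and $\epsilon>0$ there is a joint distribution of $(X,Y)$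 with margins $F,G$ under which $J(z_0)<J_\ell(z_0)+\epsilon$. *)

(* Defs.v *)
From HB Require Import structures.
From mathcomp Require Import all_boot all_order all_algebra.
From mathcomp Require Import all_classical all_reals all_analysis.

Set Implicit Arguments.
Unset Strict Implicit.
Unset Printing Implicit Defensive.

Import Order.TTheory GRing.Theory Num.Theory.
Import numFieldNormedType.Exports.

Local Open Scope classical_set_scope.
Local Open Scope ring_scope.

(* A real distribution function is an element of [cumulativeBounded 0 1]: a
   nondecreasing right-continuous function with limit 0 at -oo and 1 at +oo. *)
Notation distrfun R := (cumulativeBounded (0 : R) (1 : R)).

(* Only the values of C on the unit square matter. *)
Record is_copula (R : realType) (C : R -> R -> R) : Prop := IsCopula {
  copula_range : forall a b : R, 0 <= a <= 1 -> 0 <= b <= 1 -> 0 <= C a b <= 1 ;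
  copula_0r : forall a : R, 0 <= a <= 1 -> C a 0 = 0 ;
  copula_0l : forall a : R, 0 <= a <= 1 -> C 0 a = 0 ;
  copula_1r : forall a : R, 0 <= a <= 1 -> C a 1 = a ;
  copula_1l : forall a : R, 0 <= a <= 1 -> C 1 a = a ;
  copula_2increasing : forall a1 a2 b1 b2 : R,
    0 <= a1 -> a1 <= a2 -> a2 <= 1 -> 0 <= b1 -> b1 <= b2 -> b2 <= 1 ->
    0 <= C a2 b2 - C a1 b2 - C a2 b1 + C a1 b1 }.

Section joint_distributions.
Context {R : realType}.
Implicit Types (P : probability (R * R)%type R) (F G : distrfun R).

(* A joint distribution of (X, Y) is a Borel probability on the plane, and
   X, Y are the two coordinates. *)

Definition has_joint_cdf P (H : R -> R -> R) : Prop :=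
  forall x y : R, P [set p | p.1 <= x /\ p.2 <= y] = (H x y)%:E.

Definition has_margins P F G : Prop :=
  (forall x : R, P [set p | p.1 <= x] = (F x)%:E) /\
  (forall y : R, P [set p | p.2 <= y] = (G y)%:E).

Definition sum_cdf P (z : R) : \bar R := P [set p | p.1 + p.2 <= z].

(* The value of P(X + Y <= z) under the joint distribution with joint
   distribution function C(F(x), G(y)), which is unique by
   [joint_cdf_unique].  The default +oo, taken when there is no such
   distribution, satisfies no upper bound. *)
Definition sigma (C : R -> R -> R) F G (z : R) : \bar R :=
  xget +oo%E [set v | exists2 P, has_joint_cdf P (fun x y => C (F x) (G y)) &
                                 v = sum_cdf P z].

Definition tau_W F G (z : R) : R :=
  sup [set v | exists x y : R,
         x + y = z /\ v = Num.max (F x + G y - 1) 0].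

Definition is_lower_bound F G (J_l : R -> R) : Prop :=
  forall P, has_margins P F G -> forall z : R, ((J_l z)%:E <= sum_cdf P z)%E.

Definition pointwise_best_possible F G (J_l : R -> R) : Prop :=
  is_lower_bound F G J_l /\
  forall z0 eps : R, 0 < eps ->
    exists2 P, has_margins P F G & (sum_cdf P z0 < (J_l z0 + eps)%:E)%E.

Lemma joint_cdf_unique P Q (H : R -> R -> R) :
  has_joint_cdf P H -> has_joint_cdf Q H ->
  forall A, measurable A -> P A = Q A.
Proof.
move=> PH QH A mA.
pose G : set (set (R * R)) :=
  [set B | exists x y : R, B = [set p | p.1 <= x /\ p.2 <= y]].
have sGx (x : R) : <<s G >> [set p : R * R | p.1 <= x].
  have -> : [set p : R * R | p.1 <= x] =
      \bigcup_n [set p | p.1 <= x /\ p.2 <= n%:R].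
    rewrite eqEsubset; split=> [p /= px|p [n _ []//]].
    have [n ny] : exists n, p.2 <= n%:R.
      exists (Num.truncn `|p.2|).+1.
      by rewrite (le_trans (ler_norm _))// ltW// Num.Theory.truncnS_gt.
    by exists n.
  apply: sigma_algebra_bigcup => n; apply: sub_sigma_algebra.
  by exists x, n%:R.
have sGy (y : R) : <<s G >> [set p : R * R | p.2 <= y].
  have -> : [set p : R * R | p.2 <= y] =
      \bigcup_n [set p | p.1 <= n%:R /\ p.2 <= y].
    rewrite eqEsubset; split=> [p /= px|p [n _ []//]].
    have [n ny] : exists n, p.1 <= n%:R.
      exists (Num.truncn `|p.1|).+1.
      by rewrite (le_trans (ler_norm _))// ltW// Num.Theory.truncnS_gt.
    by exists n.
  apply: sigma_algebra_bigcup => n; apply: sub_sigma_algebra.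
  by exists n%:R, y.
have gen (f : R * R -> R) : (forall x, <<s G >> [set p | f p <= x]) ->
    forall B : set R, measurable B -> <<s G >> (f @^-1` B).
  move=> sGf B mB.
  have : <<s R.-ocitv.-measurable >> `<=`
      [set B : set R | <<s G >> (f @^-1` B)].
    apply: smallest_sub.
      split => [|C /= sC|F sF] /=.
      - by rewrite preimage_set0; exact: sigma_algebra0.
      - by rewrite setTD preimage_setC; exact: sigma_algebraC.
      - by rewrite preimage_bigcup; exact: sigma_algebra_bigcup.
    move=> _ [[a b] _ <-] /=.
    have -> : f @^-1` `]a, b] = [set p | f p <= b] `\` [set p | f p <= a].
      rewrite eqEsubset; split=> p /=; rewrite in_itv/=.
        by move=> /andP[ap pb]; split => //; apply/negP; rewrite -ltNge.
      by move=> [-> /negP]; rewrite -ltNge => ->.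
    have -> : [set p | f p <= b] `\` [set p | f p <= a] =
        ~` (\bigcup_n (if n is 0%N then ~` [set p | f p <= b] else [set p | f p <= a])).
      rewrite eqEsubset; split=> p /=.
        by move=> [pb pa] [[|n] _ /=].
      move=> np; split; first by apply: contrapT => pb; apply: np; exists 0%N.
      by move=> pa; apply: np; exists 1%N.
    apply: sigma_algebraC; apply: sigma_algebra_bigcup => -[|n] //=.
    exact: sigma_algebraC.
  exact.
have sP (x y : R) : [set p : R * R | p.1 <= x /\ p.2 <= y] =
    `]-oo, x]%classic `*` `]-oo, y]%classic.
  by rewrite eqEsubset; split=> p /=; rewrite !in_itv.
have GE : @measurable _ (R * R)%type = <<s G >>.
  rewrite eqEsubset; split.
    apply: smallest_sub; first exact: smallest_sigma_algebra.
    by move=> _ [[B mB <-]|[B mB <-]]; rewrite setTI; exact: gen.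
  apply: smallest_sub; first exact: sigma_algebra_measurable.
  move=> _ [x [y ->]]; rewrite sP; exact: measurableX.
apply: (measure_unique G (fun n => [set p | p.1 <= n%:R /\ p.2 <= n%:R])) => //.
- move=> _ _ [x1 [y1 ->]] [x2 [y2 ->]].
  exists (Num.min x1 x2), (Num.min y1 y2).
  rewrite eqEsubset; split=> p /=; rewrite !le_min.
    by move=> [[-> ->] [-> ->]].
  by move=> [/andP[-> ->] /andP[-> ->]].
- by move=> n; exists n%:R, n%:R.
- rewrite eqEsubset; split=> // p _.
  exists (Num.truncn (`|p.1| + `|p.2|)).+1 => //=.
  have /ltW le := Num.Theory.truncnS_gt (`|p.1| + `|p.2|).
  split; apply: le_trans le; rewrite (le_trans (ler_norm _))//.
    by rewrite lerDl.
  by rewrite lerDr.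
- move=> _ [x [y ->]]; transitivity (H x y)%:E; first exact: PH.
  exact/esym/QH.
- move=> n; apply: le_lt_trans (probability_le1 P _) (ltry _).
  by rewrite sP; exact: measurableX.
Qed.

End joint_distributions.

(* Main.v *)
Require Import Defs.
From HB Require Import structures.
From mathcomp Require Import all_boot all_order all_algebra.
From mathcomp Require Import all_classical all_reals all_analysis.
From mathcomp Require Import measurable_realfun.
From mathcomp Require Import ring lra.
Import Order.TTheory GRing.Theory Num.Theory.
Import numFieldNormedType.Exports.
Local Open Scope ring_scope.

(** Write s = tau_W F G z and let quantile F be the left-continuous inverse of
    F, so that, for 0 < u < 1, quantile F u <= x exactly when u <= F x
    ([quantile_le]).  If U and V are uniform on ]0, 1[, the variables
    X = quantile F U and Y = quantile G V have margins F and G, and their joint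
    distribution function is C (F x) (G y), where C is the joint distribution
    function of (U, V), a copula ([copula_of_uniforms], [quantile_coupling]).
    It remains to choose V as a function of U so that X + Y > z as often as
    possible.

    Take t slightly above s, or t = 1 if that exceeds 1.  Let U be the identity
    of ]0, 1[, let V = U where U <= t, and let V = 1 + t - U where U > t: the
    part of ]0, 1[ above t is turned upside down, so V is still uniform.
    Suppose that X + Y <= z at some u > t; then t < 1, so t > s.  Put x = X u.
    Then u <= F x, and Y u <= z - x gives 1 + t - u <= G (z - x).  Adding,
    F x + G (z - x) - 1 >= t > s, which contradicts the definition of s as a
    supremum.  Hence {X + Y <= z} lies in ]0, t] and has probability at most t,
    which is less than s + eps ([tau_W_approached]).

    That tau_W F G is itself a lower bound is the Frechet inequality
    P (A and B) >= P A + P B - 1 applied to A = {X <= x} and B = {Y <= y}, whose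
    intersection is contained in {X + Y <= x + y} ([makarov_lower_bound]). *)

Section makarov.
Local Set Implicit Arguments.
Local Unset Strict Implicit.
Local Open Scope classical_set_scope.
Context {R : realType}.
Implicit Types F G : distrfun R.

(** * Distribution functions and their quantiles *)

Lemma distrfun_nd F (x y : R) : x <= y -> F x <= F y.
Proof. exact: (cumulative_is_nondecreasing F). Qed.

Lemma distrfun_rc F (x e : R) : 0 < e ->
  exists2 d, 0 < d & F (x + d) <= F x + e.
Proof.
move=> e0; have [d Fd] := nondecreasing_right_continuousP x F e0.
by exists d%:num.
Qed.

Lemma distrfun_near_Ny F (e : R) : 0 < e ->
  exists M, forall x, x < M -> `|F x| < e.
Proof.
move=> e0; have /cvgrPdist_lt /(_ e e0) [M [_ HM]] := cumulativeNy F.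
by exists M => x /HM; rewrite sub0r normrN.
Qed.

Lemma distrfun_near_y F (e : R) : 0 < e ->
  exists M, forall x, M < x -> `|1 - F x| < e.
Proof.
move=> e0; have /cvgrPdist_lt /(_ e e0) [M [_ HM]] := cumulativey F.
by exists M => x /HM.
Qed.

Lemma distrfun01 F (x : R) : 0 <= F x <= 1.
Proof.
apply/andP; split; rewrite leNgt; apply/negP => Fx.
- have [|M HM] := @distrfun_near_Ny F (- F x); first by rewrite oppr_gt0.
  have mM : Num.min M x <= M by rewrite ge_min lexx.
  have mx : Num.min M x <= x by rewrite ge_min lexx orbT.
  have /HM : Num.min M x - 1 < M by lra.
  have : F (Num.min M x - 1) <= F x by apply: distrfun_nd; lra.
  by rewrite ltr_norml; lra.
- have [|M HM] := @distrfun_near_y F (F x - 1); first by rewrite subr_gt0.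
  have mM : M <= Num.max M x by rewrite le_max lexx.
  have mx : x <= Num.max M x by rewrite le_max lexx orbT.
  have /HM : M < Num.max M x + 1 by lra.
  have : F x <= F (Num.max M x + 1) by apply: distrfun_nd; lra.
  by rewrite ltr_norml; lra.
Qed.

Definition quantile F (u : R) : R := inf [set x | u <= F x].

(** The Galois connection between F and its quantile function.  It needs the
    infimum to be attained, which is where right-continuity enters; the limits
    at -oo and +oo make the set bounded below and nonempty when 0 < u < 1. *)
Lemma quantile_le F (u x : R) :
  0 < u < 1 -> (quantile F u <= x) = (u <= F x).
Proof.
move=> /andP[u0 u1]; set S := [set y | u <= F y].
have Slb : has_lbound S.
  have [M HM] := distrfun_near_Ny F u0; exists M => y /= uFy.
  rewrite leNgt; apply/negP => /HM /(le_lt_trans (ler_norm _)).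
  by rewrite ltNge uFy.
have S0 : S !=set0.
  have [|M HM] := @distrfun_near_y F (1 - u); first by rewrite subr_gt0.
  exists (M + 1); have : `|1 - F (M + 1)| < 1 - u by apply: HM; rewrite ltrDl.
  by rewrite ltr_norml /S/= => /andP[_]; lra.
apply/idP/idP => [qx|]; last exact: (ge_inf Slb).
(* If F were below u at the infimum, it would still be below u a little to
   the right of it, where there is a point y of the set. *)
apply: le_trans (distrfun_nd F qx); rewrite leNgt; apply/negP => Fq.
have e0 : 0 < (u - F (quantile F u)) / 2 by rewrite divr_gt0// subr_gt0.
have [d d0 Fd] := distrfun_rc F (quantile F u) e0.
have [y uFy yd] := inf_adherent d0 (conj S0 Slb).
have Fy : F y <= F (quantile F u + d) by apply: distrfun_nd; exact: ltW.
by have : u <= F y by []; lra.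
Qed.

Local Notation I01 := (`]0, 1[%classic : set R).

Lemma measurable_quantile F : measurable_fun I01 (quantile F).
Proof.
apply: (measurability (@RGenOInfty.G R)) => [|_ [_ [x ->] <-]].
  exact: RGenOInfty.measurableE.
have -> : I01 `&` quantile F @^-1` `]x, +oo[ = I01 `&` `]F x, +oo[.
  apply/seteqP; split=> u /= []; rewrite !in_itv/= !andbT => u01.
    by rewrite !(ltNge x) !(ltNge (F x)) quantile_le.
  by rewrite !(ltNge x) !(ltNge (F x)) quantile_le.
exact: measurableI.
Qed.

(** * The uniform probability on the unit interval *)

(** The open interval is used because the quantile of a distribution function
    may be infinite at 0 and at 1; [quantile_le] holds only strictly between. *)
Definition unit_uniform : set (measurableTypeR R) -> \bar R :=
  mrestr lebesgue_measure (measurable_itv (`]0, 1[)%R).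

HB.instance Definition _ := Measure.on unit_uniform.

Let unit_uniformT : unit_uniform setT = 1%E.
Proof.
rewrite /unit_uniform /mrestr setTI lebesgue_measure_itv/= lte_fin ltr01.
by rewrite oppr0 adde0.
Qed.

HB.instance Definition _ :=
  Measure_isProbability.Build _ _ _ unit_uniform unit_uniformT.

(** * Copulas as joint distributions of uniform variables *)

Lemma fine_probabilityU d (T : measurableType d) (P : probability T R) A B :
  measurable A -> measurable B ->
  fine (P (A `|` B)) = fine (P A) + fine (P B) - fine (P (A `&` B)).
Proof.
move=> mA mB.
rewrite measureUfinl//; last by rewrite ltey_eq fin_num_measure.
have mAB := measurableI _ _ mA mB.
by rewrite fineB ?fineD ?fin_numD ?fin_num_measure.
Qed.

Lemma fine_probability_le d (T : measurableType d) (P : probability T R) A B :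
  measurable A -> measurable B -> A `<=` B -> fine (P A) <= fine (P B).
Proof.
by move=> mA mB AB; rewrite fine_le ?fin_num_measure// le_measure ?inE.
Qed.

Lemma fine_probability01 d (T : measurableType d) (P : probability T R) A :
  measurable A -> 0 <= fine (P A) <= 1.
Proof.
move=> mA; rewrite fine_ge0//= -[leRHS]/(fine (1%:E : \bar R)).
by rewrite fine_le ?fin_num_measure// probability_le1.
Qed.

Definition joint_cdf d (T : measurableType d) (P : probability T R)
    (U V : T -> R) (a b : R) : R :=
  fine (P [set w | U w <= a /\ V w <= b]).

Definition uniform_rv d (T : measurableType d) (P : probability T R)
    (U : T -> R) :=
  measurable_fun setT U /\
  forall a : R, 0 <= a <= 1 -> P [set w | U w <= a] = a%:E.

Lemma measurable_sublevel d (T : measurableType d) (U : T -> R) (a : R) :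
  measurable_fun setT U -> measurable [set w | U w <= a].
Proof.
move=> mU; rewrite -[X in measurable X]setTI -preimage_itvNyc.
exact: mU.
Qed.

(** Each axiom of a copula is a consequence of monotonicity of P and of
    inclusion-exclusion.  The rectangle inequality comes from the union of
    the events (U <= a1, V <= b2) and (U <= a2, V <= b1), which is contained
    in (U <= a2, V <= b2) and whose two parts meet in (U <= a1, V <= b1). *)
Lemma copula_of_uniforms d (T : measurableType d) (P : probability T R)
    (U V : T -> R) :
  uniform_rv P U -> uniform_rv P V -> is_copula (joint_cdf P U V).
Proof.
move=> [mU PU] [mV PV].
pose A a := [set w | U w <= a]; pose B b := [set w | V w <= b].
have mA a : measurable (A a) by exact: measurable_sublevel.
have mB b : measurable (B b) by exact: measurable_sublevel.
have E a b : joint_cdf P U V a b = fine (P (A a `&` B b)) by [].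
have PA (a : R) : 0 <= a <= 1 -> fine (P (A a)) = a by move=> /PU ->.
have PB (b : R) : 0 <= b <= 1 -> fine (P (B b)) = b by move=> /PV ->.
have I0 : 0 <= (0 : R) <= 1 by rewrite lexx ler01.
have I1 : 0 <= (1 : R) <= 1 by rewrite lexx ler01.
have mAB a b : measurable (A a `&` B b) by exact: measurableI.
have bound a b : 0 <= fine (P (A a `&` B b)) <= 1 by exact: fine_probability01.
have boundU a b : 0 <= fine (P (A a `|` B b)) <= 1.
  by apply: fine_probability01; exact: measurableU.
have leA a b : fine (P (A a `&` B b)) <= fine (P (A a)).
  by apply: fine_probability_le => //; exact: subIsetl.
have leB a b : fine (P (A a `&` B b)) <= fine (P (B b)).
  by apply: fine_probability_le => //; exact: subIsetr.
have incl a b : fine (P (A a `|` B b)) =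
    fine (P (A a)) + fine (P (B b)) - fine (P (A a `&` B b)).
  exact: fine_probabilityU.
split.
- by move=> a b _ _; rewrite E.
- move=> a a01; rewrite E; have := leB a 0; have := bound a 0.
  by rewrite ?PB//; lra.
- move=> a a01; rewrite E; have := leA 0 a; have := bound 0 a.
  by rewrite ?PA//; lra.
- move=> a a01; rewrite E; have := incl a 1; have := leA a 1.
  by have := boundU a 1; rewrite PA// PB//; lra.
- move=> a a01; rewrite E; have := incl 1 a; have := leB 1 a.
  by have := boundU 1 a; rewrite PA// PB//; lra.
- move=> a1 a2 b1 b2 _ a12 _ _ b12 _; rewrite !E.
  have AA : A a1 `<=` A a2 by move=> w /le_trans; apply.
  have BB : B b1 `<=` B b2 by move=> w /le_trans; apply.
  have := fine_probabilityU P (mAB a1 b2) (mAB a2 b1).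
  have -> : (A a1 `&` B b2) `&` (A a2 `&` B b1) = A a1 `&` B b1.
    by rewrite setIACA (setIidl AA) (setIidr BB).
  have : fine (P ((A a1 `&` B b2) `|` (A a2 `&` B b1))) <=
         fine (P (A a2 `&` B b2)); last by lra.
  apply: fine_probability_le => //; first exact: measurableU.
  by rewrite subUset; split; [exact: setSI|exact: setIS].
Qed.

(** * Reversing the upper part of the unit interval *)

(** The joint distribution function of (u, flip_above t u) is the ordinal sum
    of the comonotone copula on [0, t] and the countermonotone one on [t, 1]. *)
Definition flip_above (t u : R) : R := if u <= t then u else 1 + t - u.

Lemma measurable_flip_above t : measurable_fun setT (flip_above t).
Proof.
apply: measurable_fun_ifT => //; first exact: measurable_fun_ler.
exact: measurable_funB.
Qed.

Lemma flip_above_itv (t u : R) :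
  0 < t <= 1 -> 0 < u < 1 -> 0 < flip_above t u < 1.
Proof. by move=> t01 u01; rewrite /flip_above; case: (leP u t) => ut; lra. Qed.

(** The sublevel sets of u and of flip_above t u are all of this form: an
    interval ]c, d[ is removed from ]0, 1[. *)
Lemma unit_uniform_gap (A : set R) (c d : R) :
  0 <= c -> c <= d -> d <= 1 ->
  (forall u, 0 < u < 1 -> A u <-> ~~ (c < u < d)) ->
  unit_uniform A = (1 - (d - c))%:E.
Proof.
move=> c0 cd d1 Acd; rewrite /unit_uniform /mrestr.
have -> : A `&` I01 = I01 `\` `]c, d[.
  apply/seteqP; split=> u /=; rewrite !in_itv/=.
    by move=> [Au u01]; split=> //; apply/negP; rewrite -Acd.
  by move=> [u01 /negP ncd]; split=> //; rewrite Acd.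
rewrite measureD//=; last by rewrite lebesgue_measure_itv/= lte_fin ltr01 ltry.
rewrite setIidr; last by move=> u /=; rewrite !in_itv/=; lra.
rewrite !lebesgue_measure_itv/= !lte_fin ltr01.
by have [_|dc] := ltP c d; rewrite -!EFinB; congr EFin; lra.
Qed.

Lemma uniform_id : uniform_rv unit_uniform id.
Proof.
split=> [|a a01]; first exact: measurable_id.
rewrite /= (@unit_uniform_gap _ a 1); [by congr EFin; lra|lra..|].
by move=> u u01; split=> /=; lra.
Qed.

Lemma uniform_flip_above (t : R) :
  0 < t <= 1 -> uniform_rv unit_uniform (flip_above t).
Proof.
move=> t01; split=> [|b b01]; first exact: measurable_flip_above.
(* The values at most b are taken on ]0, b] if b < t, and otherwise on ]0, t]
   and on [1 + t - b, 1[. *)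
have [bt|tb] := ltP b t.
  rewrite /= (@unit_uniform_gap _ b 1); [by congr EFin; lra|lra..|].
  by move=> u u01; rewrite /flip_above/=; case: (leP u t) => ut; split; lra.
rewrite /= (@unit_uniform_gap _ t (1 + t - b)); [by congr EFin; lra|lra..|].
by move=> u u01; rewrite /flip_above/=; case: (leP u t) => ut; split; lra.
Qed.

(** * Couplings built from quantiles *)

Section coupling.
Variables (F G : distrfun R) (U V : measurableTypeR R -> R).
Hypotheses (U01 : forall u : R, 0 < u < 1 -> 0 < U u < 1)
  (V01 : forall u : R, 0 < u < 1 -> 0 < V u < 1).
Hypotheses (unifU : uniform_rv unit_uniform U)
  (unifV : uniform_rv unit_uniform V).

Let measurable_quantile_comp (H : distrfun R) (T : measurableTypeR R -> R) :
  measurable_fun setT T -> (forall u : R, 0 < u < 1 -> 0 < T u < 1) ->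
  measurable_fun setT ((quantile H \o T) \_ I01).
Proof.
move=> mT T01; apply: (iffLR (measurable_restrictT _ (measurable_itv _))).
have TI : T @` I01 `<=` I01.
  by move=> _ [u /= + <-]; rewrite !in_itv/=; exact: T01.
exact: (measurable_comp (measurable_itv _) TI (@measurable_quantile H)
  (measurable_funTS mT)).
Qed.

(** Outside ]0, 1[ the quantiles are replaced by a constant: only their
    measurability inside is known, and the outside has probability 0. *)
Let XY (u : measurableTypeR R) : R * R :=
  (((quantile F \o U) \_ I01) u, ((quantile G \o V) \_ I01) u).

Let mXY : measurable_fun setT XY.
Proof.
exact: measurable_fun_pair (measurable_quantile_comp F unifU.1 U01)
  (measurable_quantile_comp G unifV.1 V01).
Qed.

HB.instance Definition _ := isMeasurableFun.Build _ _ _ _ XY mXY.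

Let P : probability (R * R)%type R := distribution unit_uniform XY.

Let XY_E (u : R) : I01 u -> XY u = (quantile F (U u), quantile G (V u)).
Proof. by move=> u01; rewrite /XY !patchE mem_set. Qed.

Let PE (A : set (R * R)) (B : set R) :
  (forall u : R, 0 < u < 1 -> A (quantile F (U u), quantile G (V u)) <-> B u) ->
  P A = unit_uniform B.
Proof.
move=> AB; rewrite /P /= /distribution /pushforward /unit_uniform /mrestr.
congr (lebesgue_measure _); apply/seteqP; split=> u /= [+ u01];
  rewrite XY_E// AB//; by rewrite /= in_itv in u01.
Qed.

(** By the Galois connection, the events X <= x and Y <= y are the events
    U <= F x and V <= G y.  The last clause bounds the probability of any other
    event in terms of u; it asks for an inclusion only, as the set of the u that
    satisfy A need not be measurable outside ]0, 1[. *)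
Lemma quantile_coupling : exists P : probability (R * R)%type R,
  [/\ has_joint_cdf P (fun x y => joint_cdf unit_uniform U V (F x) (G y)),
      has_margins P F G &
      forall (A : set (R * R)) (B : set R), measurable A -> measurable B ->
        (forall u : R, 0 < u < 1 ->
          A (quantile F (U u), quantile G (V u)) -> B u) ->
        (P A <= unit_uniform B)%E].
Proof.
exists P; split.
- move=> x y; rewrite /joint_cdf fineK; last first.
    by apply: fin_num_measure; apply: measurableI; apply: measurable_sublevel;
      [exact: unifU.1|exact: unifV.1].
  apply: PE => u u01 /=.
  by rewrite !quantile_le//; [exact: V01|exact: U01].
- split=> x.
    rewrite -(unifU.2 _ (distrfun01 F x)); apply: PE => u u01 /=.
    by rewrite quantile_le//; exact: U01.
  rewrite -(unifV.2 _ (distrfun01 G x)); apply: PE => u u01 /=.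
  by rewrite quantile_le//; exact: V01.
- move=> A B mA mB AB; rewrite /P /= /distribution /pushforward.
  rewrite /unit_uniform /mrestr; apply: le_measure.
  + rewrite inE; apply: measurableI => //.
    by rewrite -[X in measurable X]setTI; exact: mXY.
  + by rewrite inE; exact: measurableI.
  + move=> u /= [+ u01]; rewrite XY_E// => Au; split=> //.
    by apply: AB => //; rewrite /= in_itv in u01.
Qed.

End coupling.

(** * The Makarov bound *)

Lemma measurable_sum_le (z : R) :
  measurable [set p : R * R | p.1 + p.2 <= z].
Proof.
apply: (@measurable_sublevel _ _ (fun p : R * R => p.1 + p.2)).
exact: measurable_funD.
Qed.

(** The value chosen by sigma does not depend on the choice, since the joint
    distribution function determines the joint distribution. *)
Lemma sigma_joint_cdf P C F G (z : R) :
  has_joint_cdf P (fun x y => C (F x) (G y)) -> sigma C F G z = sum_cdf P z.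
Proof.
move=> PC; rewrite /sigma; case: xgetP => [_ -> [Q QC ->]|/(_ (sum_cdf P z))].
  by apply: (joint_cdf_unique QC PC); exact: measurable_sum_le.
by case; exists P.
Qed.

Lemma tau_W_ubound F G (z : R) :
  has_ubound [set v | exists x y : R,
         x + y = z /\ v = Num.max (F x + G y - 1) 0].
Proof.
exists 1 => _ [x [y [_ ->]]]; rewrite ge_max ler01 andbT.
by have := distrfun01 F x; have := distrfun01 G y; lra.
Qed.

Lemma le_tau_W F G (x y : R) : Num.max (F x + G y - 1) 0 <= tau_W F G (x + y).
Proof.
by apply: ub_le_sup; [exact: tau_W_ubound|exists x, y].
Qed.

Lemma tau_W_ge0 F G (z : R) : 0 <= tau_W F G z.
Proof.
rewrite -(subrK 0 z); apply: le_trans (le_tau_W F G _ _).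
by rewrite le_max lexx orbT.
Qed.

(** Frechet's inequality: P (A and B) = P A + P B - P (A or B), and the last
    term is at most 1. *)
Lemma makarov_lower_bound F G : is_lower_bound F G (tau_W F G).
Proof.
move=> P [PF PG] z.
have mz := measurable_sum_le z.
have mX x : measurable [set p : R * R | p.1 <= x] by exact: measurable_sublevel.
have mY y : measurable [set p : R * R | p.2 <= y] by exact: measurable_sublevel.
rewrite -[leRHS]fineK ?fin_num_measure// lee_fin.
apply: ge_sup; first by exists (Num.max (F z + G 0 - 1) 0), z, 0; rewrite addr0.
move=> _ [x [y [<- ->]]]; rewrite ge_max andbC.
rewrite fine_ge0//=.
have mXY := measurableI _ _ (mX x) (mY y).
have := fine_probabilityU P (mX x) (mY y).
rewrite PF PG /=.
have := fine_probability01 P (measurableU _ _ (mX x) (mY y)).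
have : fine (P ([set p | p.1 <= x] `&` [set p | p.2 <= y])) <=
    fine (sum_cdf P (x + y)); last by lra.
apply: fine_probability_le => //; first exact: measurable_sum_le.
by move=> p [/= px py]; exact: lerD.
Qed.

(** The coupling of the quantiles through [flip_above], with threshold
    t = min (s + eps / 2) 1 for s = tau_W F G z, puts mass at most t on
    {X + Y <= z}. *)
Lemma tau_W_approached F G (z eps : R) : 0 < eps ->
  exists C : R -> R -> R, exists P : probability (R * R)%type R,
  [/\ is_copula C, has_joint_cdf P (fun x y => C (F x) (G y)),
      has_margins P F G & (sum_cdf P z < (tau_W F G z + eps)%:E)%E].
Proof.
(* The minimum with 1 only serves to keep the threshold in the unit interval;
   when it equals 1, no u lies above t. *)
move=> eps0; set s := tau_W F G z; pose t := Num.min (s + eps / 2) 1.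
have s0 : 0 <= s := tau_W_ge0 F G z.
have t01 : 0 < t <= 1.
  by rewrite /t ge_min lexx orbT andbT lt_min ltr01 andbT; lra.
have T01 (u : R) : 0 < u < 1 -> 0 < flip_above t u < 1.
  exact: flip_above_itv.
have unifT := uniform_flip_above t01.
have [P [PC Pm Ps]] :=
  quantile_coupling F G (fun u u01 => u01) T01 uniform_id unifT.
exists (joint_cdf unit_uniform id (flip_above t)), P; split=> //.
  exact: copula_of_uniforms uniform_id unifT.
(* A point u > t with X + Y <= z would give F x + G (z - x) - 1 >= t > s. *)
have sub (u : R) : 0 < u < 1 ->
    quantile F u + quantile G (flip_above t u) <= z -> u <= t.
  move=> u01; apply: contraTT; rewrite -!ltNge => tu.
  rewrite ltNge; apply/negP => qz.
  have t1 : t = s + eps / 2.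
    by move: tu; rewrite /t; case: (leP (s + eps / 2) 1) => //; lra.
  pose x := quantile F u; pose y := z - x.
  have Fx : u <= F x by rewrite -quantile_le.
  have Gy : flip_above t u <= G y by rewrite -quantile_le ?T01// /y/x; lra.
  have := le_tau_W F G x y.
  rewrite ge_max (_ : x + y = z); last by rewrite /y; ring.
  by rewrite -/s; move: Gy; rewrite /flip_above (leNgt u t) tu /=; lra.
have tE := uniform_id.2 t (ltac:(lra)).
apply: (@le_lt_trans _ _ t%:E); last by rewrite lte_fin /t gt_min; lra.
rewrite -tE; apply: Ps sub; first exact: measurable_sum_le.
exact: measurable_sublevel.
Qed.

End makarov.

Theorem theorem13 (R : realType) (F G : distrfun R) :
  (forall z eps : R, 0 < eps ->
     let s := tau_W F G z in
     exists C : R -> R -> R,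
       is_copula C /\ (sigma C F G z < (s + eps)%:E)%E) /\
  (forall J_l : R -> R, is_lower_bound F G J_l ->
     forall z : R, J_l z <= tau_W F G z) /\
  pointwise_best_possible F G (tau_W F G).
Proof.
split; last split.
- move=> z eps eps0 /=.
  have [C [P [Ccop PC _ Pz]]] := tau_W_approached F G z eps0.
  by exists C; split=> //; rewrite (sigma_joint_cdf z PC).
- move=> J lbJ z; apply/ler_addgt0Pr => eps eps0.
  have [C [P [_ _ PFG Pz]]] := tau_W_approached F G z eps0.
  by rewrite -lee_fin; apply: le_trans (lbJ P PFG z) (ltW Pz).
- split; first exact: makarov_lower_bound.
  move=> z eps eps0; have [C [P [_ _ PFG Pz]]] := tau_W_approached F G z eps0.
  by exists P.
Qed.
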